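(* Let $L=\{C\}$ be the language with a single ternary relation symbol and let $T=\mathrm{Th}(\mathbb Q,C)$, where $C$ is interpreted as the cyclic order $C(a,b,c)\iff(a<b<c)\lor(b<c<a)\lor(c<a<b)$. Let $M\models T$, let $x$ be a single variable, and put $X=S_x(M)$, $G=\mathrm{Aut}(M)$. Let $f\in E(X,G)$. Then $(X)^1_{f,W}$ is finite for every $W\in\mathcal U$, where $\mathcal U$ is the unique compatible uniformity of $X$. In particular $\beta(f)\leqslant 1$ and $\beta(X,G)\leqslant 1$.
   Context: For a model $M$, $S_x(M)$ is the Stone space of complete types over $M$ in the variable(s) $x$, and $\mathrm{Aut}(M)$ (with the topology of pointwise convergence) acts on it by $\varphi(x,g(b))\in g\cdot p\iff\varphi(x,b)\in p$. A dynamical system $(X,G)$ is a compact Hausdorff space $X$ with a topological group $G$ acting continuously on $X$ by homeomorphisms; $(S_x(M),\mathrm{Aut}(M))$ is one. $\mathcal U$ denotes the unique compatible uniformity of $X$, i.e. the set of all neighbourhoods of the diagonal in $X\times X$. The Ellis semigroup $E(X,G)$ is the closure of $\{x\mapsto gx: g\in G\}$ in $X^X$ with the product (pointwise convergence) topology. For $Y\subseteq X$ closed, $f:Y\to X$ (for maps with larger domain use the restriction) and $W\in\mathcal U$, let $(Y)'_{f,W}$ be the set of $y\in Y$ such that for every open neighbourhood $V$ of $y$ in $Y$ there are $v_1,v_2\in V$ with $(f(v_1),f(v_2))\notin W$; this is a closed set. Put $(Y)^0_{f,W}=Y$, $(Y)^{\alpha+1}_{f,W}=((Y)^{\alpha}_{f,W})'_{f,W}$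 (so $(Y)^1_{f,W}=(Y)'_{f,W}$) and $(Y)^{\gamma}_{f,W}=\bigcap_{\alpha<\gamma}(Y)^{\alpha}_{f,W}$ for limit ordinals $\gamma$. Then $\beta(f,W)=\sup\{\alpha\in\mathrm{Ord}: (Y)^\alpha_{f,W}\neq\emptyset\}$, and $\beta(f,W)=\infty$ if $(Y)^\alpha_{f,W}\ne\emptyset$ for all ordinals $\alpha$. For $f:X\to X$, $\beta(f)=\sup_{W\in\mathcal U}\beta(f,W)$; and $\beta(X,G)=\sup_{f\in E(X,G)}\beta(f)$. *)

(* Defs.v *)
From HB Require Import structures.
From mathcomp Require Import all_boot all_order all_algebra.
From mathcomp Require Import all_classical topology.

Set Implicit Arguments.
Unset Strict Implicit.
Unset Printing Implicit Defensive.

Local Open Scope classical_set_scope.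

(** * First-order logic in the language with one ternary relation symbol *)

(* Formulas with parameters in [P] and free variables in [V]; under a
   quantifier, [None] is the newly bound variable.  The missing connectives and
   the existential quantifier are classical abbreviations. *)
Inductive term (P V : Type) : Type := Var of V | Par of P.
Arguments Var {P V}.
Arguments Par {P V}.

Inductive formula (P V : Type) : Type :=
| Fls
| Eqn of term P V & term P V
| Cyc of term P V & term P V & term P V
| Imp of formula P V & formula P V
| All of formula P (option V).
Arguments Fls {P V}.

Definition Neg (P V : Type) (phi : formula P V) : formula P V := Imp phi Fls.

HB.instance Definition _ (P V : Type) := gen_eqMixin (formula P V).
HB.instance Definition _ (P V : Type) := gen_choiceMixin (formula P V).

Record cstructure := CStructure {
  carrier :> Type;
  cyc : carrier -> carrier -> carrier -> Prop
}.

Definition eval (M : cstructure) (P V : Type) (b : P -> M) (e : V -> M)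
    (t : term P V) : M :=
  match t with Var v => e v | Par c => b c end.

Fixpoint sat (M : cstructure) (P V : Type) (b : P -> M) (e : V -> M)
    (phi : formula P V) : Prop :=
  match phi with
  | Fls => False
  | Eqn s t => eval b e s = eval b e t
  | Cyc s t u => cyc (eval b e s) (eval b e t) (eval b e u)
  | Imp phi psi => sat b e phi -> sat b e psi
  | All phi => forall a : M, sat b (oapp e a) phi
  end.

Definition sentence := formula void void.

Definition theory (M : cstructure) : set sentence :=
  [set s | sat (fun c : void => match c return M with end)
               (fun v : void => match v return M with end) s].

Definition models (M : cstructure) (T : set sentence) : Prop :=
  T `<=` theory M.

Definition ratC : cstructure :=
  @CStructure rat (fun a b c =>
    (a < b < c)%R \/ (b < c < a)%R \/ (c < a < b)%R).

(** * Ordinals *)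

(* Ordinals are represented by well-founded trees, [OLim g] being the supremum
   of the family [g] (which need not be increasing, so that different trees may
   represent the same ordinal: [a] and [b] do when [ole a b] and [ole b a]). *)
Inductive Ord : Type :=
| OZero
| OSucc of Ord
| OLim (A : Type) of (A -> Ord).

Fixpoint ole (a : Ord) : Ord -> Prop :=
  match a with
  | OZero => fun=> True
  | OSucc a' => fix olt_a' (b : Ord) : Prop :=
      match b with
      | OZero => False
      | OSucc b' => ole a' b'
      | OLim B g => exists i : B, olt_a' (g i)
      end
  | OLim A g => fun b => forall i : A, ole (g i) b
  end.

Definition olt (a b : Ord) : Prop := ole (OSucc a) b.

Definition OOne : Ord := OSucc OZero.

(* Ordinals extended with infinity. *)
Inductive xOrd : Type := OFin of Ord | OInfty.

Definition xle (a b : xOrd) : Prop :=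
  match a, b with
  | _, OInfty => True
  | OInfty, OFin _ => False
  | OFin a, OFin b => ole a b
  end.

Definition is_xsup (S : set xOrd) (s : xOrd) : Prop :=
  (forall a, S a -> xle a s) /\
  (forall c, (forall a, S a -> xle a c) -> xle s c).

Definition xsup (S : set xOrd) : xOrd :=
  match pselect (exists a, is_xsup S (OFin a)) with
  | left ex => OFin (projT1 (cid ex))
  | right _ => OInfty
  end.

Lemma ole_lim A (g : A -> Ord) i b : ole b (g i) -> ole b (OLim g).
Proof.
elim: b => [//|b _ bg|B h IH /= bg j].
  by exists i.
by apply: IH; apply: bg.
Qed.

Lemma ole_refl a : ole a a.
Proof. by elim: a => // A g IH i; exact: (ole_lim (IH i)). Qed.

Lemma olt_leW a b : olt a b -> ole a b.
Proof.
elim: a b => [//|a IHa|A g IH] b.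
  elim: b => [//|b _ lt|B h IHb].
    exact: (IHa b lt).
  by case=> i /IHb lti; exists i.
elim: b => [//|b _|B h IHb].
  move=> /= gb i; apply: IH; exact: gb.
by case=> i /IHb lei j; apply: (@ole_lim _ _ i); exact: lei.
Qed.

Lemma ole_trans b a c : ole a b -> ole b c -> ole a c.
Proof.
elim: a b c => [//|a IHa|A g IH] b c; last first.
  by move=> gb bc i; exact: IH (gb i) bc.
elim: b c => [//|b _|B h IHb] c; last first.
  by case=> i abi /(_ i); exact: IHb.
move=> ab; elim: c => [//|c _|C k IHc]; first exact: (IHa b c ab).
by case=> i /IHc; exists i.
Qed.

Lemma ole_or_lt a b : ole a b \/ olt b a.
Proof.
elim: a b => [|a IHa|A g IH] b; first by left.
  elim: b => [|b _|B h IHb].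
  - by right.
  - exact: (IHa b).
  - have [[i lei]|nle] := pselect (exists i, ole (OSucc a) (h i)).
      by left; exists i.
    right=> i; have [?|//] := IHb i; by case: nle; exists i.
have [gb|ngb] := pselect (forall i, ole (g i) b); first by left.
right; apply: contrapT => ngb'; apply: ngb => i.
by have [//|lt] := IH i b; case: ngb'; exists i.
Qed.

Lemma olt_wf : well_founded olt.
Proof.
suff acc a b : ole b a -> Acc olt b by move=> a; exact: acc (ole_refl a).
elim: a b => [|a IH|A g IH] b ba; constructor=> c cb; have := ole_trans cb ba.
- by [].
- exact: IH.
- by case=> i /olt_leW; exact: IH.
Qed.

Lemma xsupP S : is_xsup S (xsup S).
Proof.
rewrite /xsup; case: pselect => [ex|nex]; first exact: (projT2 (cid ex)).
split=> [[]//|[c|//] Sc]; case: nex.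
have [m + mmin] : exists2 m, (forall a, S a -> xle a (OFin m)) &
    forall d, olt d m -> ~ (forall a, S a -> xle a (OFin d)).
  elim/(well_founded_ind olt_wf): c Sc => c IH Sc.
  have [[d dc Sd]|nd] := pselect (exists2 d, olt d c &
    forall a, S a -> xle a (OFin d)); first exact: IH Sd.
  by exists c => // d dc Sd; apply: nd; exists d.
move=> Sm; exists m; split=> // -[d|//] Sd /=.
by have [//|/mmin] := ole_or_lt m d.
Qed.

(** * Dynamical systems *)

HB.mixin Record isTopologicalGroup G & Group G & Topological G := {
  mulg_continuous : continuous (fun gh : G * G => (gh.1 * gh.2)%g);
  invg_continuous : continuous (fun g : G => (g^-1)%g)
}.

#[short(type="topologicalGroupType")]
HB.structure Definition TopologicalGroup :=
  {G of Group G & Topological G & isTopologicalGroup G}.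

Record dynamical_system := DynamicalSystem {
  ds_space :> topologicalType;
  ds_group : topologicalGroupType;
  ds_act : ds_group -> ds_space -> ds_space;
  ds_compact : compact [set: ds_space];
  ds_hausdorff : hausdorff_space ds_space;
  ds_act1 : forall x, ds_act 1%g x = x;
  ds_actM : forall g h x, ds_act (g * h)%g x = ds_act g (ds_act h x);
  ds_act_continuous :
    continuous (fun gx : ds_group * ds_space => ds_act gx.1 gx.2)
}.

Definition ellis (X : dynamical_system) : set {ptws X -> X} :=
  closure (range (fun g => ds_act g : {ptws X -> X})).
Arguments ellis X : clear implicits.

(* For compact Hausdorff [X], this is the unique compatible uniformity. *)
Definition diag_nbhds (X : topologicalType) : set (set (X * X)) :=
  [set W | forall x : X, nbhs (x, x) W].
Arguments diag_nbhds X : clear implicits.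

Definition osc_deriv (X : topologicalType) (f : X -> X) (W : set (X * X))
    (Y : set X) : set X :=
  [set y | Y y /\ forall V : set X, open V -> V y ->
     exists v1 v2, [/\ (Y `&` V) v1, (Y `&` V) v2 & ~ W (f v1, f v2)]].

(* The intersection with [Y] in the last case only matters for the empty
   family, whose supremum is zero. *)
Fixpoint osc_iter (X : topologicalType) (f : X -> X) (W : set (X * X))
    (Y : set X) (a : Ord) : set X :=
  match a with
  | OZero => Y
  | OSucc a' => osc_deriv f W (osc_iter f W Y a')
  | OLim A g => Y `&` \bigcap_(i in [set: A]) osc_iter f W Y (g i)
  end.

Definition osc_rank (X : topologicalType) (f : X -> X) (W : set (X * X))
    : xOrd :=
  xsup [set OFin a | a in [set a | osc_iter f W [set: X] a !=set0]].

Definition beta_map (X : topologicalType) (f : X -> X) : xOrd :=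
  xsup [set osc_rank f W | W in diag_nbhds X].

Definition beta_system (X : dynamical_system) : xOrd :=
  xsup [set beta_map f | f in ellis X].

Lemma osc_deriv_sub (X : topologicalType) (f : X -> X) W (Y Z : set X) :
  Y `<=` Z -> osc_deriv f W Y `<=` osc_deriv f W Z.
Proof.
move=> YZ y [Yy yV]; split; first exact: YZ.
move=> V oV Vy; have [v1 [v2 [[Y1 V1] [Y2 V2] nW]]] := yV V oV Vy.
by exists v1, v2; split=> //; split=> //; exact: YZ.
Qed.

(* In particular, [osc_iter] only depends on the ordinal that [a] represents. *)
Lemma osc_iter_ole (X : topologicalType) (f : X -> X) W (Y : set X) a b :
  ole a b -> osc_iter f W Y b `<=` osc_iter f W Y a.
Proof.
elim: a b => [|a IHa|A g IH] b.
- move=> _; elim: b => [//|b IHb y [/IHb//]|B h _ y []//].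
- elim: b => [//|b _ ab|B h IHb [i abi]].
    by apply: osc_deriv_sub; exact: IHa.
  by move=> y [_ hy]; apply: (IHb i abi); exact: hy.
- move=> gb y by_; split; last by move=> i _; exact: IH (gb i) _ by_.
  by elim: b by_ {gb} => [//|b IHb [/IHb//]|B h _ []//].
Qed.

(** * Types over a structure *)

(* [p] is finitely satisfiable in [M], which for sets of formulas over [M] means
   consistent with the elementary diagram of [M]. *)
Definition finitely_satisfiable (M : cstructure)
    (p : set (formula M unit)) : Prop :=
  forall s : seq (formula M unit), (forall phi, phi \in s -> p phi) ->
  exists a : M, forall phi, phi \in s -> sat id (fun=> a) phi.

Record ctype (M : cstructure) := CType {
  ctype_set :> formula M unit -> Prop;
  ctype_finsat : finitely_satisfiable ctype_set;
  ctype_complete : forall phi, ctype_set phi \/ ctype_set (Neg phi)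
}.

HB.instance Definition _ M := gen_eqMixin (ctype M).
HB.instance Definition _ M := gen_choiceMixin (ctype M).

Lemma ctype_ext M (p q : ctype M) : ctype_set p `<=` q -> p = q.
Proof.
move=> pq; have e : ctype_set p = q.
  apply/seteqP; split=> // phi qphi.
  have [//|/pq qn] := ctype_complete p phi.
  have [phi' |a sata] := @ctype_finsat _ q [:: phi; Neg phi].
    by rewrite !inE => /orP[] /eqP ->.
  have /= := sata (Neg phi); rewrite !inE eqxx orbT => /(_ isT)[].
  by apply: sata; rewrite !inE eqxx.
case: p q e {pq} => p fp cp [q fq cq] /= e; case: _ / e in fq cq *.
by congr CType; exact: Prop_irrelevance.
Qed.

Lemma ctype_sat M (p : ctype M) (s : seq (formula M unit)) psi :
  (forall phi, phi \in s -> p phi) ->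
  (forall a : M, (forall phi, phi \in s -> sat id (fun=> a) phi) ->
     sat id (fun=> a) psi) -> p psi.
Proof.
move=> sp spsi; have [//|pn] := ctype_complete p psi.
have [phi|a sata] := @ctype_finsat _ p (Neg psi :: s).
  by rewrite inE => /orP[/eqP->//|/sp].
have := sata (Neg psi); rewrite inE eqxx => /(_ isT)[].
by apply: spsi => phi phis; apply: sata; rewrite inE phis orbT.
Qed.

Definition And (P V : Type) (phi psi : formula P V) : formula P V :=
  Neg (Imp phi (Neg psi)).

Lemma ctype_And M (p : ctype M) phi psi : p (And phi psi) <-> p phi /\ p psi.
Proof.
split=> [pp|[pphi ppsi]].
  split; apply: (@ctype_sat _ p [:: And phi psi]).
  - by move=> ?; rewrite inE => /eqP->.
  - move=> a /(_ (And phi psi)); rewrite inE eqxx => /(_ isT) /= h.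
    by apply: contrapT => n; apply: h => /n.
  - by move=> ?; rewrite inE => /eqP->.
  - move=> a /(_ (And phi psi)); rewrite inE eqxx => /(_ isT) /= h.
    by apply: contrapT => n; apply: h => _ /n.
apply: (@ctype_sat _ p [:: phi; psi]).
  by move=> ?; rewrite !inE => /orP[] /eqP->.
move=> a sata /=; apply; apply: sata; by rewrite !inE eqxx ?orbT.
Qed.

(* The Stone topology. *)
Definition ctype_open M (A : set (ctype M)) : Prop :=
  forall p, A p -> exists phi, p phi /\ [set q : ctype M | q phi] `<=` A.

Lemma ctype_openT M : ctype_open [set: ctype M].
Proof.
by move=> p _; have [?|?] := ctype_complete p Fls; eexists; split; eauto.
Qed.

Lemma ctype_openI M (A B : set (ctype M)) :
  ctype_open A -> ctype_open B -> ctype_open (A `&` B).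
Proof.
move=> oA oB p [/oA[phi [pphi phiA]] /oB[psi [ppsi psiB]]].
exists (And phi psi); split; first exact/ctype_And.
by move=> q /ctype_And[qphi qpsi]; split; [exact: phiA|exact: psiB].
Qed.

Lemma ctype_open_bigU M (I : Type) (F : I -> set (ctype M)) :
  (forall i, ctype_open (F i)) -> ctype_open (\bigcup_i F i).
Proof.
move=> oF p [i _ /oF[phi [pphi phiF]]]; exists phi; split=> // q /phiF.
by exists i.
Qed.

HB.instance Definition _ M := @isOpenTopological.Build (ctype M)
  (@ctype_open M) (@ctype_openT M) (@ctype_openI M) (@ctype_open_bigU M).

Lemma ctype_openE M (A : set (ctype M)) : open A = ctype_open A.
Proof. by []. Qed.

Lemma ctype_basic_open M phi : open [set q : ctype M | q phi].
Proof. by move=> p pphi; exists phi; split. Qed.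

Lemma ctype_hausdorff M : hausdorff_space (ctype M).
Proof.
move=> p q pq; apply: ctype_ext => phi pphi.
have [//|qn] := ctype_complete q phi.
have bnbhs (r : ctype M) psi : r psi -> nbhs r [set r : ctype M | r psi].
  by move=> rpsi; apply: open_nbhs_nbhs; split=> //; exact: ctype_basic_open.
have [r [/= rphi rn]] := pq _ _ (bnbhs p _ pphi) (bnbhs q _ qn).
have [phi'|a sata] := @ctype_finsat _ r [:: phi; Neg phi].
    by rewrite !inE => /orP[] /eqP ->.
  have /= := sata (Neg phi); rewrite !inE eqxx orbT => /(_ isT)[].
  by apply: sata; rewrite !inE eqxx.
Qed.

Lemma ctype_compact M : compact [set: ctype M].
Proof.
rewrite compact_ultra => F UF _.
have PF : ProperFilter F := ultra_proper.
pose l : set (formula M unit) := [set phi | F [set q : ctype M | q phi]].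
have lfs : finitely_satisfiable l.
  move=> s sl.
  have : F [set q : ctype M | forall phi, phi \in s -> q phi].
    elim: s sl => [|phi s IH] sl.
      by apply: (@filterS _ F _ setT); [move=> q _ phi|exact: filterT].
    have Fphi : F [set q : ctype M | q phi].
      by apply: (sl phi); rewrite inE eqxx.
    have Fs : F [set q : ctype M | forall phi, phi \in s -> q phi].
      by apply: IH => psi h; apply: sl; rewrite inE h orbT.
    apply: filterS (filterI Fphi Fs) => q [qphi qs] psi.
    by rewrite inE => /orP[/eqP->//|/qs].
  move=> /filter_ex[q qs]; exact: (ctype_finsat qs).
have lc phi : l phi \/ l (Neg phi).
  have [?|Fn] := in_ultra_setVsetC [set q : ctype M | q phi] UF.
    by left.
  right; apply: filterS Fn => q /= nq.
  by have [] := ctype_complete q phi.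
exists (CType lfs lc); split=> // A.
rewrite nbhsE => -[U [oU Up] UA].
have [phi [lphi phiU]] := oU _ Up.
apply: filterS lphi; exact: subset_trans phiU UA.
Qed.

(** * The automorphism group and its action on types *)

Record caut (M : cstructure) := CAut {
  caut_fun :> M -> M;
  caut_inv : M -> M;
  caut_funK : cancel caut_fun caut_inv;
  caut_invK : cancel caut_inv caut_fun;
  caut_cyc : forall a b c,
    cyc (caut_fun a) (caut_fun b) (caut_fun c) <-> cyc a b c
}.

HB.instance Definition _ M := gen_eqMixin (caut M).
HB.instance Definition _ M := gen_choiceMixin (caut M).

Lemma caut_ext M (g h : caut M) : g =1 h -> g = h.
Proof.
move=> /funext e; have ei : caut_inv g = caut_inv h.
  by apply/funext => x; rewrite -{1}(caut_invK h x) -e caut_funK.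
case: g h e ei => g gi a b c [h hi a' b' c'] /= e ei.
case: _ / e in a' b' c' *; case: _ / ei in a' b' c' *.
by congr CAut; exact: Prop_irrelevance.
Qed.

Section caut_group.
Variable M : cstructure.
Implicit Types g h : caut M.

Definition caut1 : caut M :=
  @CAut M id id (fun=> erefl) (fun=> erefl) (fun _ _ _ => iff_refl _).

Lemma cautM_cyc g h a b c :
  cyc (g (h a)) (g (h b)) (g (h c)) <-> cyc a b c.
Proof. by rewrite !caut_cyc. Qed.

Definition cautM g h : caut M :=
  @CAut M (g \o h) (caut_inv h \o caut_inv g)
    (can_comp (caut_funK g) (caut_funK h))
    (can_comp (caut_invK h) (caut_invK g)) (@cautM_cyc g h).

Lemma cautV_cyc g a b c :
  cyc (caut_inv g a) (caut_inv g b) (caut_inv g c) <-> cyc a b c.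
Proof. by rewrite -(caut_cyc g) !caut_invK. Qed.

Definition cautV g : caut M :=
  @CAut M (caut_inv g) g (caut_invK g) (caut_funK g) (@cautV_cyc g).

Lemma cautA : associative cautM. Proof. by move=> ? ? ?; exact: caut_ext. Qed.
Lemma caut1M : left_id caut1 cautM. Proof. by move=> ?; exact: caut_ext. Qed.
Lemma cautM1 : right_id caut1 cautM. Proof. by move=> ?; exact: caut_ext. Qed.
Lemma cautVM : left_inverse caut1 cautV cautM.
Proof. by move=> g; apply: caut_ext => x; exact: caut_funK. Qed.
Lemma cautMV : right_inverse caut1 cautV cautM.
Proof. by move=> g; apply: caut_ext => x; exact: caut_invK. Qed.

HB.instance Definition _ :=
  isGroup.Build (caut M) cautA caut1M cautM1 cautVM cautMV.

(* The topology of pointwise convergence, [M] being discrete. *)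
Definition caut_open (A : set (caut M)) : Prop :=
  forall g, A g -> exists2 D : set M, finite_set D &
    forall h, {in D, h =1 g} -> A h.

Lemma caut_openT : caut_open setT.
Proof. by move=> g _; exists set0. Qed.

Lemma caut_openI A B : caut_open A -> caut_open B -> caut_open (A `&` B).
Proof.
move=> oA oB g [/oA[D fD DA] /oB[E fE EB]].
exists (D `|` E); first by rewrite finite_setU.
move=> h hg; split.
  by apply: DA => a /set_mem aD; apply/hg/mem_set; left.
by apply: EB => a /set_mem aE; apply/hg/mem_set; right.
Qed.

Lemma caut_open_bigU (I : Type) (F : I -> set (caut M)) :
  (forall i, caut_open (F i)) -> caut_open (\bigcup_i F i).
Proof.
move=> oF g [i _ /oF[D fD DF]]; exists D => // h /DF Fh; by exists i.
Qed.

HB.instance Definition _ := @isOpenTopological.Build (caut M)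
  caut_open caut_openT caut_openI caut_open_bigU.

Lemma caut_nbhsP (g : caut M) (A : set (caut M)) :
  nbhs g A <-> exists2 D : set M, finite_set D &
    forall h : caut M, {in D, h =1 g} -> A h.
Proof.
rewrite nbhsE; split=> [[U [oU Ug] UA]|[D fD DA]].
  have [D fD DU] := oU g Ug; by exists D => // h /DU /UA.
exists [set h : caut M | {in D, h =1 g}]; last by move=> h /DA.
split; last by [].
suff : caut_open [set h : caut M | {in D, h =1 g}] by [].
move=> h hg; exists D => // k kh a aD.
by rewrite kh// hg.
Qed.

Lemma caut_mul_continuous :
  continuous (fun gh : caut M * caut M => (gh.1 * gh.2)%g).
Proof.
move=> [g h] A /caut_nbhsP[D fD DA].
exists ([set k : caut M | {in h @` D, k =1 g}],
        [set k : caut M | {in D, k =1 h}]); last first.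
  move=> [k l] [/= kg lh]; apply: DA => a aD /=.
  rewrite /= lh// kg//; apply/mem_set; exists a => //; exact: set_mem.
split; apply/caut_nbhsP; [exists (h @` D)|exists D] => //.
exact: finite_image.
Qed.

Lemma caut_inv_continuous : continuous (fun g : caut M => (g^-1)%g).
Proof.
move=> g A /caut_nbhsP[D fD DA]; apply/caut_nbhsP.
exists (caut_inv g @` D); first exact: finite_image.
move=> h hg; apply: DA => a aD /=.
apply: (can_inj (caut_funK h)); rewrite [LHS]caut_invK hg ?caut_invK//.
by apply/mem_set; exists a => //; exact: set_mem.
Qed.

HB.instance Definition _ := isTopologicalGroup.Build (caut M)
  caut_mul_continuous caut_inv_continuous.

End caut_group.

Definition tmap (P Q V : Type) (u : P -> Q) (t : term P V) : term Q V :=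
  match t with Var v => Var v | Par c => Par (u c) end.

(* Replacing each parameter [c] by [u c]. *)
Fixpoint fmap (P Q V : Type) (u : P -> Q) (phi : formula P V) : formula Q V :=
  match phi with
  | Fls => Fls
  | Eqn s t => Eqn (tmap u s) (tmap u t)
  | Cyc s t v => Cyc (tmap u s) (tmap u t) (tmap u v)
  | Imp phi psi => Imp (fmap u phi) (fmap u psi)
  | All phi => All (fmap u phi)
  end.

Lemma fmap_id (P V : Type) (phi : formula P V) : fmap id phi = phi.
Proof.
have t_id (W : Type) (t : term P W) : tmap id t = t by case: t.
elim: phi => {V} //=.
- by move=> V s t; rewrite !t_id.
- by move=> V s t v; rewrite !t_id.
- by move=> V phi -> psi ->.
- by move=> V phi ->.
Qed.

Lemma fmap_comp (P Q R V : Type) (u : P -> Q) (v : Q -> R)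
    (phi : formula P V) :
  fmap v (fmap u phi) = fmap (v \o u) phi.
Proof.
have tc (W : Type) (t : term P W) : tmap v (tmap u t) = tmap (v \o u) t.
  by case: t.
elim: phi => {V} //=.
- by move=> V s t; rewrite !tc.
- by move=> V s t w; rewrite !tc.
- by move=> V phi -> psi ->.
- by move=> V phi ->.
Qed.

Lemma sat_fmap (M : cstructure) (g : caut M) (V : Type) (e : V -> M)
    (phi : formula M V) :
  sat id (g \o e) (fmap g phi) <-> sat id e phi.
Proof.
have ev (W : Type) (d : W -> M) t :
    eval id (g \o d) (tmap g t) = g (eval id d t).
  by case: t.
elim: phi e => {V} /=.
- by [].
- by move=> V s t e; rewrite !ev; split=> [/(can_inj (caut_funK g))|->].
- by move=> V s t v e; rewrite !ev caut_cyc.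
- by move=> V phi IH psi IH' e; rewrite IH IH'.
- move=> V phi IH e.
  have ext a : oapp (g \o e) (g a) = g \o oapp e a by apply/funext; case.
  split=> [h a|h a]; first by apply/IH; rewrite -ext.
  by rewrite -(caut_invK g a) ext; apply/IH.
Qed.

Lemma fmap_finite (P V : Type) (phi : formula P V) :
  exists2 D : set P, finite_set D &
  forall (Q : Type) (u v : P -> Q), {in D, u =1 v} -> fmap u phi = fmap v phi.
Proof.
have tf (W : Type) (t : term P W) : exists2 D : set P, finite_set D &
  forall (Q : Type) (u v : P -> Q), {in D, u =1 v} -> tmap u t = tmap v t.
  case: t => [w|c]; first by exists set0.
  exists [set c] => // Q u v uv /=; by rewrite uv//; apply/mem_set.
have inU (D E : set P) Q (u v : P -> Q) :
    {in D `|` E, u =1 v} -> {in D, u =1 v} /\ {in E, u =1 v}.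
  by move=> uv; split=> x /set_mem xD; apply/uv/mem_set; [left|right].
elim: phi => {V}
  [V|V s t|V s t w|V phi [D fD hD] psi [E fE hE]|V phi [D fD hD]].
- by exists set0.
- have [D fD hD] := tf _ s; have [E fE hE] := tf _ t.
  exists (D `|` E); first by rewrite finite_setU.
  by move=> Q u v /inU[/hD Du /hE Eu] /=; rewrite Du Eu.
- have [D fD hD] := tf _ s; have [E fE hE] := tf _ t.
  have [F fF hF] := tf _ w.
  exists (D `|` E `|` F); first by rewrite !finite_setU.
  by move=> Q u v /inU[/inU[/hD Du /hE Eu] /hF Fu] /=; rewrite Du Eu Fu.
- exists (D `|` E); first by rewrite finite_setU.
  by move=> Q u v /inU[/hD Du /hE Eu] /=; rewrite Du Eu.
- by exists D => // Q u v /hD Du /=; rewrite Du.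
Qed.

Section ctype_action.
Variable M : cstructure.
Implicit Types (g h : caut M) (p : ctype M).

Definition ctype_act_set g p : set (formula M unit) :=
  [set phi | p (fmap (g^-1)%g phi)].

Lemma ctype_act_finsat g p : finitely_satisfiable (ctype_act_set g p).
Proof.
move=> s sp.
have [phi|a sata] := @ctype_finsat _ p (map (fmap (g^-1)%g) s).
  by move=> /mapP[psi psis ->]; exact: sp.
exists (g a) => phi phis.
have /sata/(sat_fmap g) : fmap (g^-1)%g phi \in map (fmap (g^-1)%g) s.
  exact: map_f.
by rewrite fmap_comp (_ : g \o _ = id) ?fmap_id//; apply/funext => b;
  exact: caut_invK.
Qed.

Lemma ctype_act_complete g p phi :
  ctype_act_set g p phi \/ ctype_act_set g p (Neg phi).
Proof. exact: (ctype_complete p (fmap (g^-1)%g phi)). Qed.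

Definition ctype_act g p : ctype M :=
  CType (@ctype_act_finsat g p) (@ctype_act_complete g p).

Lemma ctype_actP g p phi : ctype_act g p (fmap g phi) <-> p phi.
Proof.
rewrite /= /ctype_act_set /= fmap_comp (_ : _ \o _ = id) ?fmap_id//.
by apply/funext => b; exact: caut_funK.
Qed.

Lemma ctype_act1 p : ctype_act 1%g p = p.
Proof. by apply: ctype_ext => phi; rewrite /= /ctype_act_set /= fmap_id. Qed.

Lemma ctype_actM g h p : ctype_act (g * h)%g p = ctype_act g (ctype_act h p).
Proof.
by apply: ctype_ext => phi; rewrite /= /ctype_act_set /= fmap_comp.
Qed.

Lemma ctype_act_continuous :
  continuous (fun gp : caut M * ctype M => ctype_act gp.1 gp.2).
Proof.
move=> [g p] A; rewrite nbhsE => -[U [oU Up] UA].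
have [phi [pphi phiU]] := oU _ Up.
have [D fD hD] := fmap_finite phi.
exists ([set k : caut M | {in caut_inv g @` D, k =1 g}],
        [set q : ctype M | q (fmap (g^-1)%g phi)]); last first.
  move=> [k q] [/= kg qphi]; apply/UA/phiU.
  rewrite /= /ctype_act_set /= (hD _ _ (g^-1)%g)// => a aD.
  apply: (can_inj (caut_funK k)); rewrite [LHS]caut_invK kg ?[RHS]caut_invK//.
  by apply/mem_set; exists a => //; exact: set_mem.
split.
  by apply/caut_nbhsP; exists (caut_inv g @` D) => //; exact: finite_image.
by apply: open_nbhs_nbhs; split=> //; exact: ctype_basic_open.
Qed.

End ctype_action.

Definition type_system (M : cstructure) : dynamical_system :=
  @DynamicalSystem (ctype M) (caut M) (@ctype_act M) (@ctype_compact M)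
    (@ctype_hausdorff M) (@ctype_act1 M) (@ctype_actM M)
    (@ctype_act_continuous M).

(* Main.v *)
Require Import Defs.
From HB Require Import structures.
From mathcomp Require Import all_boot all_order all_algebra.
From mathcomp Require Import all_classical topology.
From mathcomp Require Import finmap lra.

Set Implicit Arguments.
Unset Strict Implicit.
Unset Printing Implicit Defensive.

Import Order.TTheory.

Local Open Scope classical_set_scope.

(** A dense cyclic order has quantifier elimination, so a type in one variable
    over [M] is either realized or a cut of the cyclic order, and clopen sets
    of types are finite unions of points and arcs.  By compactness, every
    neighbourhood [W] of the diagonal contains all pairs of types that agree on
    the atomic formulas over some finite [A] ([diag_nbhds_qf]); call the classes
    of this relation [A]-cells.  Near a point of the first derivative, [f] does
    not stay inside a single [A]-cell, and the claim is that there are at most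
    [size A] points of this kind.

    Suppose that [ps] is a finite list of such points.  None of them is
    realized, since realized types are isolated.  A finite [B] separates the
    points of [ps], which therefore lie in pairwise disjoint arcs cut out by
    [B].  In the arc of each [y] there are two types whose images under [f]
    are in different [A]-cells.  As [f] is a pointwise limit of automorphisms,
    a single automorphism [g] agrees with [f] on these finitely many types as
    far as [A]-cells are concerned ([ellis_approx]).  But an arc that contains
    no point of [g^-1 A] lies in one [g^-1 A]-cell, so that [g] would send it
    into one [A]-cell ([follows_homogeneous], [cell_agree]).  Each arc thus
    contains some [g^-1 a] with [a] in [A]; the arcs being disjoint, this
    injects [ps] into [A] ([osc_deriv_finite]).

    Finally a finite subspace of a Hausdorff space is discrete, so its
    derivative is empty ([osc_deriv_discrete]); all ranks are at most one.

    Quantifier elimination is obtained by back and forth, between finite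
    partial isomorphisms of [M] rather than by automorphisms, of which [M] may
    have too few.  Both the extension step and the description of arcs rest on
    one notion: [x] follows [b] in [B] when, going round from [b], one meets
    [x] before any point of [B].  Where [x] stands relative to [B] is then
    determined by [b] ([follows_cyc]). *)

(** * Axioms of dense cyclic orders *)

HB.instance Definition _ (M : cstructure) := gen_eqMixin (carrier M).
HB.instance Definition _ (P V : Type) := gen_eqMixin (term P V).

Record dense_cyclic_order (M : cstructure) : Prop := DenseCyclicOrder {
  cyc_point : exists a : M, True;
  cyc_other : forall a : M, exists b : M, a <> b;
  cyc_rot : forall a b c : M, cyc a b c -> cyc b c a;
  cyc_asym : forall a b c : M, cyc a b c -> ~ cyc a c b;
  cyc_trans : forall a b c d : M, cyc a b c -> cyc a c d -> cyc a b d;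
  cyc_total : forall a b c : M, a <> b -> b <> c -> a <> c ->
    cyc a b c \/ cyc a c b;
  cyc_dense : forall a b : M, a <> b -> exists c, cyc a c b
}.

Local Notation x0 := (Var None).
Local Notation x1 := (Var (Some None)).
Local Notation x2 := (Var (Some (Some None))).
Local Notation x3 := (Var (Some (Some (Some None)))).

(** Each property is, up to classical equivalence, a sentence true in the
    rationals. *)
Lemma models_dense_cyclic_order (M : cstructure) :
  models M (theory ratC) -> dense_cyclic_order M.
Proof.
move=> MT.
split.
- have /MT /= h : theory ratC (Neg (All Fls)) by move=> /(_ 0%R).
  by apply: contrapT => n; apply: h => a; apply: n; exists a.
- have /MT /= h : theory ratC (All (Neg (All (Eqn x1 x0)))).
    by move=> /= a /(_ (a + 1)%R); lra.
  by move=> a; apply: contrapT => n; apply: (h a) => b;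
    apply: contrapT => nab; apply: n; exists b.
- have /MT /= h : theory ratC
      (All (All (All (Imp (Cyc x2 x1 x0) (Cyc x1 x0 x2))))).
    by move=> /= a b c; tauto.
  exact: h.
- have /MT /= h : theory ratC
      (All (All (All (Imp (Cyc x2 x1 x0) (Neg (Cyc x2 x0 x1)))))).
    by move=> /= a b c; lra.
  exact: h.
- have /MT /= h : theory ratC (All (All (All (All
      (Imp (Cyc x3 x2 x1) (Imp (Cyc x3 x1 x0) (Cyc x3 x2 x0))))))).
    by move=> /= a b c d; lra.
  exact: h.
- have /MT /= h : theory ratC (All (All (All (Imp (Neg (Eqn x2 x1))
    (Imp (Neg (Eqn x1 x0)) (Imp (Neg (Eqn x2 x0))
    (Imp (Neg (Cyc x2 x1 x0)) (Cyc x2 x0 x1)))))))).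
    move=> /= a b c; case: (ltgtP a b) => // ab; case: (ltgtP b c) => // bc;
    by case: (ltgtP a c) => // ac; lra.
  move=> a b c ab bc ac; apply: contrapT => n.
  by apply: (n); right; apply: h => // abc; apply: n; left.
- have /MT /= h : theory ratC (All (All (Imp (Neg (Eqn x1 x0))
     (Neg (All (Neg (Cyc x2 x0 x1))))))).
    move=> /= a b ab h; case: (ltgtP a b) => // {}ab.
      by apply: (h ((a + b) / 2%:R)%R); lra.
    by apply: (h (a + 1)%R); lra.
  move=> a b ab; apply: contrapT => n; apply: (h a b ab) => c abc.
  by apply: n; exists c.
Qed.

(** * Combinatorics of cyclic orders and partial isomorphisms *)

Section cyclic_combinatorics.
Variables (M : cstructure) (HM : dense_cyclic_order M).
Implicit Types (a b c d p m n x y : M) (A B : seq M).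

Let rot := cyc_rot HM.
Let asym := cyc_asym HM.
Let trans := cyc_trans HM.
Let total := cyc_total HM.

Lemma cyc_rotE a b c : cyc a b c <-> cyc b c a.
Proof. by split=> [/rot//|/rot/rot]. Qed.

Lemma cyc_neq a b c : cyc a b c -> [/\ a <> b, b <> c & a <> c].
Proof.
move=> h; split=> e; subst.
- exact: (asym (rot (rot h)) (rot (rot h))).
- exact: (asym h h).
- exact: (asym (rot h) (rot h)).
Qed.

Lemma cyc_trans_right a b c d : cyc a b c -> cyc a c d -> cyc b c d.
Proof.
by move=> /rot/rot cab /rot cda; exact: rot (rot (trans cda cab)).
Qed.

(** For [b] in [B], these [x] form the open arc from [b] to the next point of
    [B], or the complement of [b] when [B] has no other point. *)
Definition follows B b x : Prop :=
  x <> b /\ forall c, c \in B -> c <> b -> cyc b x c.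

(** Density, used once for each point of [B]: a new point [c] lying between [b]
    and the [x] found so far is avoided by moving [x] back between [b] and
    [c]. *)
Lemma exists_follows B b : exists x, follows B b x.
Proof.
elim: B => [|c B [x [xb xB]]].
  by have [x bx] := cyc_other HM b; exists x; split=> // e; exact: bx.
have [cb|cb] := pselect (c = b).
  exists x; split=> // d; rewrite inE => /orP[/eqP->//|]; exact: xB.
have [bxc|nbxc] := pselect (cyc b x c).
  by exists x; split=> // d; rewrite inE => /orP[/eqP->//|]; exact: xB.
have [y byc] := cyc_dense HM (nesym cb).
have byx : cyc b y x.
  have [->//|cx] := pselect (x = c).
  by have [//|bcx] := total (nesym xb) cx (nesym cb); exact: trans byc bcx.
have [/nesym yb _ _] := cyc_neq byc.
exists y; split=> // d; rewrite inE => /orP[/eqP->//|dB db].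
exact: trans byx (xB d dB db).
Qed.

(** [b] is the last point of [B] met before [x]; when a point [c] is added, the
    new choice is [b] or [c] according to their order as seen from [x]. *)
Lemma follows_some B x : x \notin B -> B != [::] ->
  exists2 b, b \in B & follows B b x.
Proof.
elim: B => // c B IH; rewrite inE negb_or => /andP[/eqP xc xB] _.
have [->|/(IH xB)[b bB [xb hb]]] := eqVneq B [::].
  by exists c; rewrite ?inE ?eqxx//; split=> // d; rewrite inE => /eqP.
have [cb|cb] := pselect (c = b).
  exists b; first by rewrite inE bB orbT.
  by split=> // d; rewrite inE => /orP[/eqP->//|]; exact: hb.
have [bxc|bcx] := total (nesym xb) xc (nesym cb).
  exists b; first by rewrite inE bB orbT.
  by split=> // d; rewrite inE => /orP[/eqP->//|]; exact: hb.
exists c; first by rewrite inE eqxx.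
split=> // d; rewrite inE => /orP[/eqP->//|dB dc].
have [->|db] := pselect (d = b); first exact: rot.
exact: cyc_trans_right bcx (hb d dB db).
Qed.

Lemma follows_notin B b x : b \in B -> follows B b x -> x \notin B.
Proof.
move=> bB [xb xB]; apply/negP => xinB.
by have [_ + _] := cyc_neq (xB x xinB xb).
Qed.

Lemma follows_inj B b c x : b \in B -> c \in B ->
  follows B b x -> follows B c x -> b = c.
Proof.
move=> bB cB [xb hb] [xc hc]; apply: contrapT => bc.
exact: (asym (hb c cB (nesym bc)) (rot (rot (hc b bB bc)))).
Qed.

(** As seen from [x], the points of [B] occur in the order in which they occur
    as seen from [b], except that [b] comes last. *)
Lemma follows_cyc B b x c d : follows B b x -> c \in B -> d \in B ->
  cyc x c d <-> cyc b c d \/ (d = b /\ c <> b).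
Proof.
move=> [xb xB] cB dB; split=> [xcd|].
  have [cb|cb] := pselect (c = b).
    subst c; have [_ bd xd] := cyc_neq xcd.
    by case: (asym (rot xcd)); apply: xB => // e; exact: bd.
  have [db|db] := pselect (d = b); [by right|left].
  have [_ cd _] := cyc_neq xcd.
  have [//|bdc] := total (nesym cb) cd (nesym db).
  by case: (asym xcd); exact: cyc_trans_right (xB d dB db) bdc.
case=> [bcd|[-> cb]]; last by apply: rot; exact: xB.
have [/nesym cb _ _] := cyc_neq bcd.
exact: cyc_trans_right (xB c cB cb) bcd.
Qed.

(** If [m] comes before [n] in the arc starting at [b], everything between [b]
    and [n] is in the arc, hence outside [A].  Both [m] and [n] then follow [b]
    in [b :: A], which by [follows_cyc] fixes their position relative to
    [A]. *)
Lemma follows_homogeneous B A b m n : follows B b m -> follows B b n ->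
  (forall a, a \in A -> ~ follows B b a) ->
  forall c d, c \in A -> d \in A -> cyc c m d <-> cyc c n d.
Proof.
wlog bmn : m n / cyc b m n => [hwlog|] Fm Fn FA c d cA dA.
  have [->//|mn] := pselect (m = n).
  have [bmn|bnm] := total (nesym Fm.1) mn (nesym Fn.1); first exact: hwlog.
  by apply: iff_sym; exact: hwlog.
have after_n a : a \in A -> a <> b -> cyc b n a.
  move=> aA ab; have na : n <> a by move=> e; apply: (FA a aA); rewrite -e.
  have [//|ban] := total (nesym Fn.1) na (nesym ab).
  case: (FA a aA); split=> // e eB eb; exact: trans ban (Fn.2 e eB eb).
have An : follows (b :: A) b n.
  split=> [|a]; first exact: Fn.1.
  by rewrite inE => /orP[/eqP->//|]; exact: after_n.
have Am : follows (b :: A) b m.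
  split=> [|a]; first exact: Fm.1.
  by rewrite inE => /orP[/eqP->//|] aA ab; exact: trans bmn (after_n a aA ab).
have cA' : c \in b :: A by rewrite inE cA orbT.
have dA' : d \in b :: A by rewrite inE dA orbT.
rewrite (cyc_rotE c m) (cyc_rotE c n).
by rewrite (follows_cyc Am dA' cA') (follows_cyc An dA' cA').
Qed.

Definition partial_iso (s : seq (M * M)) : Prop :=
  (forall u v, u \in s -> v \in s -> u.1 = v.1 <-> u.2 = v.2) /\
  (forall u v w, u \in s -> v \in s -> w \in s ->
    cyc u.1 v.1 w.1 <-> cyc u.2 v.2 w.2).

Lemma partial_iso_sub s t : {subset t <= s} -> partial_iso s -> partial_iso t.
Proof. by move=> ts [e c]; split=> *; [apply: e|apply: c]; exact: ts. Qed.

Lemma partial_iso_swap s :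
  partial_iso [seq (u.2, u.1) | u <- s] -> partial_iso s.
Proof.
move=> [e c]; split=> [u v us vs|u v w us vs ws]; apply: iff_sym.
  by apply: (e (u.2, u.1) (v.2, v.1)); exact: (map_f (fun u => (u.2, u.1))).
by apply: (c (u.2, u.1) (v.2, v.1) (w.2, w.1));
  exact: (map_f (fun u => (u.2, u.1))).
Qed.

Lemma partial_iso_cons s x x' : partial_iso s ->
  (forall u, u \in s -> x = u.1 <-> x' = u.2) ->
  (forall u v, u \in s -> v \in s -> cyc x u.1 v.1 <-> cyc x' u.2 v.2) ->
  partial_iso ((x, x') :: s).
Proof.
move=> [se sc] xe xc.
have deg a b : ~ cyc a a b /\ ~ cyc a b a /\ ~ cyc b a a.
  by split; [|split] => /cyc_neq[].
split=> [u v|u v w]; rewrite !inE.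
  case/orP=> [/eqP->|us] /orP[/eqP->|vs] //=; [exact: xe| |exact: se].
  by split=> /esym/(xe _ us)/esym.
case/orP=> [/eqP->|us] /orP[/eqP->|vs] /orP[/eqP->|ws] /=.
- by split=> /(proj1 (deg _ _)).
- by split=> /(proj1 (deg _ _)).
- by split=> /(proj1 (proj2 (deg _ _))).
- exact: xc.
- by split=> /(proj2 (proj2 (deg _ _))).
- by rewrite (cyc_rotE u.1) (cyc_rotE u.2); exact: xc.
- by rewrite -(cyc_rotE x) -(cyc_rotE x'); exact: xc.
- exact: sc.
Qed.

(** The forth step.  A new [x] follows some [p] in the domain; any [x'] that
    follows the image of [p] in the range is a suitable image of [x]. *)
Lemma partial_iso_extend s x : partial_iso s ->
  exists x', partial_iso ((x, x') :: s).
Proof.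
move=> sI; have [se sc] := sI.
have [xs|xs] := boolP (x \in [seq u.1 | u <- s]).
  have [u us ->] := mapP xs; exists u.2.
  apply: partial_iso_sub sI => v; rewrite inE => /orP[/eqP->|//].
  by case: u us {xs}.
have [s0|s0] := eqVneq s [::].
  have [a _] := cyc_point HM; exists a; rewrite s0.
  by apply: partial_iso_cons => //.
have [|_ /mapP[p ps ->] Fx] := follows_some xs; first by case: (s) s0.
have [x' Fx'] := exists_follows [seq u.2 | u <- s] p.2.
have in1 u : u \in s -> u.1 \in [seq u.1 | u <- s] by exact: map_f.
have in2 u : u \in s -> u.2 \in [seq u.2 | u <- s] by exact: map_f.
have xs' := follows_notin (in2 _ ps) Fx'.
exists x'; apply: partial_iso_cons => // [u us|u v us vs].
  split=> e; first by rewrite e in1 in xs.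
  by rewrite e in2 in xs'.
rewrite (follows_cyc Fx (in1 _ us) (in1 _ vs)).
rewrite (follows_cyc Fx' (in2 _ us) (in2 _ vs)).
by rewrite (sc p u v)// (se v p)// (se u p).
Qed.

End cyclic_combinatorics.

(** * Quantifier elimination *)

(** The terms that do not mention the newly bound variable. *)
Definition lower_term (P V : Type) (t : term P (option V)) :
    option (term P V) :=
  match t with
  | Var v => omap Var v
  | Par c => Some (Par c)
  end.

(** The list [ts] records the terms that occur in [phi].  At a quantifier, the
    value of the bound variable is moved across by [partial_iso_extend], and
    the other terms are those of [lower_term]. *)
Lemma sat_partial_iso (M : cstructure) (HM : dense_cyclic_order M) (V : Type)
    (phi : formula M V) : exists ts : seq (term M V), forall e e' : V -> M,
  partial_iso [seq (Defs.eval id e t, Defs.eval id e' t) | t <- ts] ->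
  sat id e phi <-> sat id e' phi.
Proof.
elim: phi => {V}
  [V|V s t|V s t u|V phi [ts hts] psi [us hus]|V phi [ts hts]].
- by exists [::].
- exists [:: s; t] => e e' [h _].
  by apply: (h (Defs.eval id e s, Defs.eval id e' s)
    (Defs.eval id e t, Defs.eval id e' t));
    rewrite !inE eqxx ?orbT.
- exists [:: s; t; u] => e e' [_ h].
  by apply: (h (Defs.eval id e s, Defs.eval id e' s)
    (Defs.eval id e t, Defs.eval id e' t)
    (Defs.eval id e u, Defs.eval id e' u)); rewrite !inE eqxx ?orbT.
- exists (ts ++ us) => e e'; rewrite map_cat => h.
  have hphi : sat id e phi <-> sat id e' phi.
    by apply: hts; apply: partial_iso_sub h => u hu; rewrite mem_cat hu.
  have hpsi : sat id e psi <-> sat id e' psi.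
    by apply: hus; apply: partial_iso_sub h => u hu; rewrite mem_cat hu orbT.
  by split=> /= H /hphi/H/hpsi.
- exists (pmap (@lower_term M V) ts) => e e' h /=.
  have key (d d' : V -> M) a a' : partial_iso ((a, a') ::
      [seq (Defs.eval id d t, Defs.eval id d' t)
        | t <- pmap (@lower_term M V) ts]) ->
      sat id (oapp d a) phi <-> sat id (oapp d' a') phi.
    move=> h'; apply: hts; apply: partial_iso_sub h' => _ /mapP[t tts ->].
    have low t' : lower_term t = Some t' -> t' \in pmap (@lower_term M V) ts.
      by move=> e1; rewrite mem_pmap -e1 map_f.
    rewrite inE; case: t low {tts} => [[v|]|c] /= low.
    + by apply/orP; right; apply/mapP; exists (Var v) => //; exact: low.
    + by rewrite eqxx.
    + by apply/orP; right; apply/mapP; exists (Par c) => //; exact: low.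
  split=> H a.
    have h' : partial_iso [seq (Defs.eval id e' t, Defs.eval id e t)
        | t <- pmap (@lower_term M V) ts].
      by apply: partial_iso_swap; rewrite -map_comp.
    have [a' ha] := partial_iso_extend HM a h'.
    by apply/(key _ _ _ _ ha).
  have [a' ha] := partial_iso_extend HM a h.
  by apply/(key _ _ _ _ ha).
Qed.

Section one_variable.
Variable M : cstructure.
Implicit Types (a b c m n : M) (A B : seq M) (phi : formula M unit).

Definition eq_formula a : formula M unit := Eqn (Var tt) (Par a).
Definition arc_formula a b : formula M unit := Cyc (Par a) (Var tt) (Par b).

Definition qf_formulas A : seq (formula M unit) :=
  [seq eq_formula a | a <- A] ++ [seq arc_formula a b | a <- A, b <- A].

Definition agree (L : seq (formula M unit)) (P Q : formula M unit -> Prop) :=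
  forall phi, phi \in L -> P phi <-> Q phi.

Definition elt_type m : formula M unit -> Prop := sat id (fun=> m).

Lemma agree_sym L P Q : agree L P Q -> agree L Q P.
Proof. by move=> h phi pL; exact: iff_sym (h _ pL). Qed.

Lemma agree_trans L P Q R : agree L P Q -> agree L Q R -> agree L P R.
Proof. by move=> h h' phi pL; exact: iff_trans (h _ pL) (h' _ pL). Qed.

Lemma agree_sub L L' P Q : {subset L <= L'} -> agree L' P Q -> agree L P Q.
Proof. by move=> LL' h phi /LL'/h. Qed.

Lemma agree_qfP A P Q : agree (qf_formulas A) P Q <->
  (forall a, a \in A -> P (eq_formula a) <-> Q (eq_formula a)) /\
  (forall a b, a \in A -> b \in A ->
     P (arc_formula a b) <-> Q (arc_formula a b)).
Proof.
split=> [h|[he hc] phi].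
  split=> [a aA|a b aA bA]; apply: h; rewrite mem_cat.
    by rewrite map_f.
  by apply/orP; right; apply/allpairsP; exists (a, b).
rewrite mem_cat => /orP[/mapP[a aA ->]|/allpairsP[[a b] [/= aA bA ->]]].
  exact: he.
exact: hc.
Qed.

Lemma qf_formulas_sub A B : {subset A <= B} ->
  {subset qf_formulas A <= qf_formulas B}.
Proof.
move=> AB phi; rewrite !mem_cat.
case/orP => [/mapP[a /AB aB ->]|/allpairsP[[a b] [/= /AB aB /AB bB ->]]].
  by rewrite map_f.
by apply/orP; right; apply/allpairsP; exists (a, b).
Qed.

(** The identity on [A] extended by [m |-> n] is a partial isomorphism. *)
Lemma formula_support (HM : dense_cyclic_order M) phi :
  exists A, forall m n, agree (qf_formulas A) (elt_type m) (elt_type n) ->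
    elt_type m phi <-> elt_type n phi.
Proof.
have [ts hts] := sat_partial_iso HM phi.
pose par (t : term M unit) := if t is Par c then Some c else None.
exists (pmap par ts) => m n /agree_qfP[he hc]; apply: hts.
apply: (@partial_iso_sub _ ((m, n) :: [seq (c, c) | c <- pmap par ts])).
  move=> _ /mapP[t tts ->]; rewrite inE; case: t tts => [[]|c] tts /=.
    by rewrite eqxx.
  apply/orP; right; apply: (map_f (fun c => (c, c))).
  by rewrite mem_pmap -[Some c]/(par (Par c)) map_f.
apply: partial_iso_cons => //.
- split=> [_ _ /mapP[a _ ->] /mapP[b _ ->]//|].
  by move=> _ _ _ /mapP[a _ ->] /mapP[b _ ->] /mapP[c _ ->].
- by move=> _ /mapP[a aA ->]; exact: (he a).
- move=> _ _ /mapP[a aA ->] /mapP[b bA ->] /=.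
  by rewrite -!(cyc_rotE HM b); exact: (hc b a).
Qed.

(** Types behave like elements as long as finitely many formulas are concerned;
    this is how facts about [M] are transferred to types. *)
Lemma ctype_realized (p : ctype M) L : exists m, agree L p (elt_type m).
Proof.
pose signed phi := if pselect (p phi) then phi else Neg phi.
have [_ /mapP[psi _ ->]|m hm] := @ctype_finsat _ p [seq signed phi | phi <- L].
  rewrite /signed; case: pselect => // np.
  by have [] := ctype_complete p psi.
exists m => phi pL; have := hm _ (map_f signed pL); rewrite /signed.
by case: pselect => pphi /= mphi; split=> // /mphi.
Qed.

Lemma ctype_support (HM : dense_cyclic_order M) phi :
  exists A, forall p q : ctype M, agree (qf_formulas A) p q ->
    p phi <-> q phi.
Proof.
have [A hA] := formula_support HM phi; exists A => p q pq.
have [m hm] := ctype_realized p (phi :: qf_formulas A).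
have [n hn] := ctype_realized q (phi :: qf_formulas A).
have tl : {subset qf_formulas A <= phi :: qf_formulas A}.
  by move=> psi h; rewrite inE h orbT.
rewrite (hm phi) ?(hn phi) ?inE ?eqxx//; apply: hA.
apply: agree_trans (agree_sub tl hn).
by apply: agree_trans pq; apply: agree_sym; exact: agree_sub tl hm.
Qed.

Lemma ctype_separated (HM : dense_cyclic_order M) (ps : seq (ctype M)) :
  exists B, forall p q : ctype M,
    p \in ps -> q \in ps -> agree (qf_formulas B) p q -> p = q.
Proof.
have sep (p q : ctype M) : exists B, agree (qf_formulas B) p q -> p = q.
  have [->|pq] := pselect (p = q); first by exists [::].
  have [phi /not_implyP[pphi nq]] : exists phi, ~ (p phi -> q phi).
    by apply/existsNP => h; apply: pq; exact: ctype_ext.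
  by have [B hB] := ctype_support HM phi; exists B => /hB[/(_ pphi)].
have [F hF] := choice (fun pq : ctype M * ctype M => sep pq.1 pq.2).
exists (flatten [seq F (p, q) | p <- ps, q <- ps]) => p q pps qps h.
apply: (hF (p, q)); apply: agree_sub h; apply: qf_formulas_sub => a aF.
by apply/flattenP; exists (F (p, q)) => //; apply/allpairsP; exists (p, q).
Qed.

(** [follows B b] as a finite list of formulas, so that it also makes sense for
    types. *)
Definition follows_formulas B b : seq (formula M unit) :=
  Neg (eq_formula b) :: [seq arc_formula b c | c <- B & c != b].

Lemma follows_formulasP B b m :
  (forall phi, phi \in follows_formulas B b -> elt_type m phi) <->
  follows B b m.
Proof.
split=> [h|[mb hB] phi].
  split=> [|c cB cb]; first exact: (h (Neg (eq_formula b)) (mem_head _ _)).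
  apply: (h (arc_formula b c)); rewrite inE; apply/orP; right.
  by apply: map_f; rewrite mem_filter cB andbT; apply/eqP.
rewrite inE => /orP[/eqP->//|/mapP[c + ->]].
by rewrite mem_filter => /andP[/eqP cb cB]; exact: hB.
Qed.

Definition cell B b : set (ctype M) :=
  [set p | forall phi, phi \in follows_formulas B b -> p phi].

Lemma cell_open B b : open (cell B b).
Proof.
suff all_open (L : seq (formula M unit)) :
    open [set p : ctype M | forall phi, phi \in L -> p phi].
  exact: all_open.
elim: L => [|phi L IH].
  suff -> : [set p : ctype M | forall phi,
      phi \in ([::] : seq (formula M unit)) -> p phi] = setT.
    exact: openT.
  by apply/seteqP; split.
suff -> : [set p : ctype M | forall psi, psi \in phi :: L -> p psi] =
    [set p : ctype M | p phi] `&`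
    [set p : ctype M | forall psi, psi \in L -> p psi].
  by apply: openI => //; exact: ctype_basic_open.
apply/seteqP; split=> [p h|p [h h'] psi].
  by split=> [|psi pL]; apply: h; rewrite inE ?eqxx ?pL ?orbT.
by rewrite inE => /orP[/eqP->//|/h'].
Qed.

Lemma cell_realized B b (p : ctype M) L : cell B b p ->
  exists m, follows B b m /\ agree L p (elt_type m).
Proof.
move=> pb; have [m hm] := ctype_realized p (follows_formulas B b ++ L).
exists m; split; last first.
  by apply: agree_sub hm => phi pL; rewrite mem_cat pL orbT.
by apply/follows_formulasP => phi h; apply/hm; rewrite ?mem_cat ?h//; exact: pb.
Qed.

Lemma cell_agree (HM : dense_cyclic_order M) A B b (p q : ctype M) :
  cell B b p -> cell B b q -> (forall a, a \in A -> ~ follows B b a) ->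
  agree (qf_formulas A) p q.
Proof.
move=> /(cell_realized (qf_formulas A))[m [Fm pm]].
move=> /(cell_realized (qf_formulas A))[n [Fn qn]] FA.
apply: (agree_trans pm); apply: agree_trans (agree_sym qn).
apply/agree_qfP; split=> [a aA|a c aA cA].
  by split=> e; case: (FA a aA); [rewrite -(e : m = a)|rewrite -(e : n = a)].
exact: (follows_homogeneous HM Fm Fn FA).
Qed.

Lemma cell_cover (HM : dense_cyclic_order M) B (p : ctype M) : B != [::] ->
  (forall a, ~ p (eq_formula a)) -> exists2 b, b \in B & cell B b p.
Proof.
move=> B0 pn.
have [m hm] := ctype_realized p
  ([seq eq_formula a | a <- B] ++ flatten [seq follows_formulas B b | b <- B]).
have mB : m \notin B.
  apply/negP => mB; apply: (pn m); apply/hm => //.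
  by rewrite mem_cat map_f.
have [b bB /follows_formulasP Fb] := follows_some HM mB B0.
exists b => // phi hphi; apply/hm; last exact: Fb.
rewrite mem_cat; apply/orP; right; apply/flattenP.
by exists (follows_formulas B b) => //; exact: map_f.
Qed.

End one_variable.

(** * Types, neighbourhoods and the Ellis semigroup *)

Lemma ctype_negP (M : cstructure) (p : ctype M) phi : p (Neg phi) <-> ~ p phi.
Proof.
have [m hm] := ctype_realized p [:: phi; Neg phi].
by rewrite (hm (Neg phi)) ?(hm phi) ?inE ?eqxx ?orbT.
Qed.

Lemma agree_nbhs (M : cstructure) (p : ctype M) L :
  nbhs p [set q : ctype M | agree L p q].
Proof.
elim: L => [|phi L IH]; first by apply: filterE => q phi; rewrite inE.
pose psi := if pselect (p phi) then phi else Neg phi.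
have psi_nbhs : nbhs p [set q : ctype M | q psi].
  apply: open_nbhs_nbhs; split; first exact: ctype_basic_open.
  by rewrite /psi /=; case: pselect => // np; apply/ctype_negP.
apply: filterS2 psi_nbhs IH => q /= qpsi qL chi.
rewrite inE => /orP[/eqP->|/qL//]; move: qpsi; rewrite /psi.
by case: pselect => pphi; [|move=> /ctype_negP].
Qed.

(** Realized types are isolated. *)
Lemma realized_unique (M : cstructure) (p q : ctype M) a :
  p (eq_formula a) -> q (eq_formula a) -> p = q.
Proof.
move=> pa qa; apply: ctype_ext => phi pphi.
have [m hm] := ctype_realized p [:: phi; eq_formula a].
have [n hn] := ctype_realized q [:: phi; eq_formula a].
have ma : m = a by apply/(hm (eq_formula a)); rewrite ?inE ?eqxx ?orbT.
have na : n = a by apply/(hn (eq_formula a)); rewrite ?inE ?eqxx ?orbT.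
apply/hn; rewrite ?inE ?eqxx// na -ma.
by apply/hm; rewrite ?inE ?eqxx.
Qed.

(** An automorphism [g] maps [g^-1 A]-cells to [A]-cells. *)
Lemma agree_act (M : cstructure) (g : caut M) A (p q : ctype M) :
  agree (qf_formulas (map (caut_inv g) A)) p q ->
  agree (qf_formulas A) (ctype_act g p) (ctype_act g q).
Proof.
move=> /agree_qfP[he hc]; apply/agree_qfP; split=> [a aA|a b aA bA].
  exact: (he _ (map_f _ aA)).
exact: (hc _ _ (map_f _ aA) (map_f _ bA)).
Qed.

(** By compactness, the space is covered by finitely many basic open sets whose
    squares are contained in [W]; [A] collects the points that determine their
    formulas. *)
Lemma diag_nbhds_qf (M : cstructure) (HM : dense_cyclic_order M)
    (W : set (ctype M * ctype M)) : diag_nbhds (ctype M) W ->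
  exists A, forall p q : ctype M, agree (qf_formulas A) p q -> W (p, q).
Proof.
move=> WU.
pose D : set (formula M unit) := [set phi |
  forall p q : ctype M, p phi -> q phi -> W (p, q)].
have [[p0 _]|none] := pselect (exists p : ctype M, True); last first.
  by exists [::] => p; case: none; exists p.
have cpt : cover_compact [set: ctype M].
  pose X : ptopologicalType := HB.pack (ctype M) (isPointed.Build (ctype M) p0).
  have := @ctype_compact M; rewrite -[compact _]/(@compact X [set: X]).
  by rewrite compact_cover.
have := cpt _ D (fun phi => [set p : ctype M | p phi]).
case=> [phi _|p _|Phi PhiD cov]; first exact: ctype_basic_open.
  have [[U V] [/= Up Vp] UV] := WU p.
  have : nbhs p (U `&` V) by exact: filterI.
  rewrite nbhsE => -[O [oO Op] OUV]; have [phi [pphi phiO]] := oO _ Op.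
  exists phi => //= q r qphi rphi.
  by apply: UV; split=> /=; [have [] := OUV q (phiO _ qphi)
    |have [] := OUV r (phiO _ rphi)].
have [S hS] := choice (ctype_support HM).
exists (flatten [seq S phi | phi <- enum_fset Phi]) => p q pq.
have [phi /= phiPhi pphi] := cov p I.
apply: (set_mem (PhiD _ phiPhi)) => //.
apply/(hS phi p q) => //; apply: agree_sub pq; apply: qf_formulas_sub => a aS.
by apply/flattenP; exists (S phi) => //; exact: map_f.
Qed.

(** The conditions on [g] define a basic neighbourhood of [f] for pointwise
    convergence. *)
Lemma ellis_approx (M : cstructure) (f : ctype M -> ctype M)
    (ps : seq (ctype M)) L : ellis (type_system M) f ->
  exists g : caut M, forall p, p \in ps -> agree L (f p) (ctype_act g p).
Proof.
move=> ef.
pose U : set {ptws ctype M -> ctype M} :=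
  [set h | forall p, p \in ps -> agree L (f p) (h p)].
have : nbhs (f : {ptws ctype M -> ctype M}) U.
  rewrite /U; elim: (ps) => [|p s IH].
    by apply: filterE => h p; rewrite in_nil.
  have Np : nbhs (f : {ptws ctype M -> ctype M})
      [set h | agree L (f p) (h p)].
    exact: (@proj_continuous _ (fun=> ctype M) p f _ (agree_nbhs (f p) L)).
  apply: filterS2 Np IH => h hp hs q.
  by rewrite inE => /orP[/eqP->//|/hs].
by move=> /ef[_ [[g _ <-] gU]]; exists g.
Qed.

Lemma finite_set_bounded (T : choiceType) (S : set T) (n : nat) :
  (forall s : seq T, uniq s -> (forall x, x \in s -> S x) -> size s <= n)%N ->
  finite_set S.
Proof.
move=> bnd; apply: contrapT => /(infinite_set_fset n.+1)[D DS nD].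
have : (size (enum_fset D) <= n)%N.
  by apply: bnd => [|x]; [exact: fset_uniq|exact: DS].
by rewrite leqNgt nD.
Qed.

(** The finite set has at most [size A] elements, for [A] as in
    [diag_nbhds_qf]: its points lie in disjoint arcs, and each of these arcs
    contains a point of [g^-1 A] for a suitable automorphism [g]. *)
Lemma osc_deriv_finite (M : cstructure) (HM : dense_cyclic_order M)
    (f : ctype M -> ctype M) (W : set (ctype M * ctype M)) :
  ellis (type_system M) f -> diag_nbhds (ctype M) W ->
  finite_set (osc_deriv f W [set: ctype M]).
Proof.
move=> ef WU; have [A hA] := diag_nbhds_qf HM WU.
apply: (@finite_set_bounded _ _ (size A)) => ps ups osc.
have unrealized p a : p \in ps -> ~ p (eq_formula a).
  move=> pps pa.
  have [_ /(_ [set q : ctype M | q (eq_formula a)])] := osc p pps.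
  case=> [||v [w [[_ va] [_ wa]]]]; [exact: ctype_basic_open|by []|].
  by apply; rewrite (realized_unique va wa); exact: nbhs_singleton (WU _).
(* The point [o] makes [B] nonempty, so that the arcs cover its complement. *)
have [B0 hB0] := ctype_separated HM ps.
have [o _] := cyc_point HM; pose B := o :: B0.
(* [t p] is the start of the arc of [p] and two types of the arc that [f]
   separates. *)
have /choice[t ht] : forall p : ctype M,
    exists t : M * (ctype M * ctype M), p \in ps ->
    [/\ t.1 \in B, cell B t.1 p, cell B t.1 t.2.1, cell B t.1 t.2.2 &
        ~ W (f t.2.1, f t.2.2)].
  move=> p; have [pps|npps] := boolP (p \in ps); last by exists (o, (p, p)).
  have [|b bB pb] := @cell_cover _ HM B p isT.
    by move=> a; exact: unrealized.
  have [_ /(_ _ (@cell_open M B b) pb)[v [w [[_ vb] [_ wb] nW]]]] := osc p pps.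
  by exists (b, (v, w)).
have [g hg] := ellis_approx
  ([seq (t p).2.1 | p <- ps] ++ [seq (t p).2.2 | p <- ps]) (qf_formulas A) ef.
(* If no [g^-1 a] is in the arc, [g] cannot separate the two types. *)
have /choice[h hh] : forall p : ctype M, exists a, p \in ps ->
    a \in A /\ follows B (t p).1 (caut_inv g a).
  move=> p; have [pps|npps] := boolP (p \in ps); last by exists o.
  have [bB pb vb wb nW] := ht p pps.
  apply: contrapT => /forallNP none; apply: nW; apply: hA.
  have gv := hg (t p).2.1; have gw := hg (t p).2.2.
  apply: agree_trans (gv _) _.
    by rewrite mem_cat (map_f (fun p => (t p).2.1)).
  apply: agree_trans (agree_sym (gw _)); last first.
    by rewrite mem_cat (map_f (fun p => (t p).2.2))// orbT.
  apply: agree_act; apply: (cell_agree HM vb wb) => _ /mapP[a aA ->] Fa.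
  by apply: (none a).
rewrite -(size_map h); apply: uniq_leq_size => [|_ /mapP[p pps ->]]; last first.
  by have [] := hh p pps.
rewrite map_inj_in_uniq// => p q pps qps e.
have [pB pcell _ _ _] := ht p pps; have [qB qcell _ _ _] := ht q qps.
have [_ Fp] := hh p pps; have [_ Fq] := hh q qps.
have eb : (t p).1 = (t q).1.
  by apply: (follows_inj HM pB qB Fp); rewrite e.
apply: hB0 => //; apply: (@agree_sub _ _ (qf_formulas B)).
  by apply: qf_formulas_sub => b bB; rewrite inE bB orbT.
rewrite -eb in qcell; apply: (cell_agree HM pcell qcell) => b bB Fb.
by move: (follows_notin HM pB Fb); rewrite bB.
Qed.

(** Some neighbourhood of [y] meets the finite set [Y] only in [y]. *)
Lemma osc_deriv_discrete (X : topologicalType) (f : X -> X) (W : set (X * X))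
    (Y : set X) : hausdorff_space X -> finite_set Y -> diag_nbhds X W ->
  osc_deriv f W Y = set0.
Proof.
move=> hX fY WU; rewrite -subset0 => y [Yy osc].
have oV : open (~` (Y `\ y)).
  have /accessible_finite_set_closed fin_closed := hausdorff_accessible hX.
  apply: closed_openC; apply: fin_closed.
  by apply: (sub_finite_set _ fY) => z [].
have [|v [w [[Yv Vv] [Yw Vw] nW]]] := osc _ oV.
  by move=> [_ /(_ erefl)].
have eq_y z : Y z -> (~` (Y `\ y)) z -> z = y.
  by move=> Yz nz; apply: contrapT => zy; apply: nz.
by apply: nW; rewrite (eq_y v)// (eq_y w)//; exact: nbhs_singleton (WU _).
Qed.

Lemma xsup_le (S : set xOrd) c : (forall a, S a -> xle a c) -> xle (xsup S) c.
Proof. by move=> Sc; apply: (xsupP S).2. Qed.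

Theorem theorem3p11 (M : cstructure) (MT : models M (theory ratC)) :
  (forall f : type_system M -> type_system M, ellis (type_system M) f ->
     (forall W : set (type_system M * type_system M),
        diag_nbhds (type_system M) W ->
        finite_set (osc_iter f W [set: type_system M] OOne)) /\
     xle (beta_map f) (OFin OOne)) /\
  xle (beta_system (type_system M)) (OFin OOne).
Proof.
have HM := models_dense_cyclic_order MT.
have fin f W : ellis (type_system M) f -> diag_nbhds (type_system M) W ->
    finite_set (osc_iter f W [set: type_system M] OOne).
  exact: osc_deriv_finite.
have rank f : ellis (type_system M) f -> xle (beta_map f) (OFin OOne).
  move=> ef; apply: xsup_le => _ [W WU <-]; apply: xsup_le => _ [a a0 <-] /=.
  have [//|/osc_iter_ole a2] := ole_or_lt a OOne.
  have osc2 : osc_iter f W [set: type_system M] (OSucc OOne) = set0.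
    apply: osc_deriv_discrete (fin f W ef WU) WU; exact: ctype_hausdorff.
  by have [y] := a0; move=> /a2; rewrite osc2.
split=> [f ef|]; first by split=> [W|]; [exact: fin|exact: rank].
by apply: xsup_le => _ [f ef <-]; exact: rank.
Qed.
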